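(* Consider the system $$\dot p+(\mu-\nu)qr=0,\qquad \dot q+(\nu-\lambda)rp=0,\qquad \dot r+(\lambda-\mu)pq=0 .$$ Let $\lambda>\mu>\nu$, $\lambda\nu<0$, $|\mu|\ll\lambda$ and $\lambda\sim|\nu|$ (with $\mu\neq0$). Let $W(t)=\lambda^6p(t)^2+\mu^6q(t)^2+\nu^6r(t)^2$ be the $\mathbf{H}^3$-norm squared of an orbit of this system. Choose initial data such that $W(0)=\lambda^6p(0)^2+\mu^6q(0)^2$ with $\lambda^6p(0)^2\sim\frac12W(0)$ and $\mu^6q(0)^2\sim\frac12W(0)$. Then there exists $t^*>0$ such that $$W(t^* )\ \ge\ \frac14\Big(\frac{\lambda}{\mu}\Big)^6W(0),\qquad\text{where}\qquad t^*\ \le\ \frac{6}{\sqrt{W(0)}}\,\mu^2\,\ln\Big(\frac{\lambda}{|\mu|}\Big)\Big(\frac{\lambda}{|\mu|}\Big)^{-1}.$$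
   Context: $\lambda,\mu,\nu$ are real parameters and $p,q,r$ are real-valued functions of $t$; $W(0)>0$. The relations $\ll$ and $\sim$ are asymptotic: the conclusion is asserted in the regime where $|\mu|/\lambda$ is sufficiently small and $\lambda/|\nu|$, $2\lambda^6p(0)^2/W(0)$, $2\mu^6q(0)^2/W(0)$ are sufficiently close to $1$. *)

(* Defs.v *)
From Stdlib Require Import Reals.
From Coquelicot Require Import Coquelicot.
Open Scope R_scope.

(* An orbit is a solution on the whole time line.  [Derive] is total (junk
   value where the derivative does not exist), hence the [ex_derive] clauses. *)
Definition is_orbit (lam mu nu : R) (p q r : R -> R) : Prop :=
  forall t : R,
    ex_derive p t /\ ex_derive q t /\ ex_derive r t /\
    Derive p t + (mu - nu) * q t * r t = 0 /\
    Derive q t + (nu - lam) * r t * p t = 0 /\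
    Derive r t + (lam - mu) * p t * q t = 0.

Definition H3_norm_sq (lam mu nu : R) (p q r : R -> R) (t : R) : R :=
  lam ^ 6 * p t ^ 2 + mu ^ 6 * q t ^ 2 + nu ^ 6 * r t ^ 2.

(* Main.v *)
(** The middle axis is unstable.  Write [a = mu - nu], [b = lam - nu],
    [c = lam - mu]; the quantities [c p^2 - a r^2] and [b p^2 + a q^2] are
    conserved and [y = sqrt c p - sqrt a r] solves the linear equation
    [y' = sqrt (a c) q y].  If [W] stayed below the claimed value up to the
    claimed time [T], conservation would keep [q^2] above about [q(0)^2 / 2],
    so [y] would grow exponentially.  The rate [q(0) / sqrt 2] on all of [0, T]
    is exactly critical, so two phases are needed: up to [9/10 T] either [y]
    has already become comparable to [q(0)] or [q] is still close to [q(0)],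
    and the better rate forces the former; the remaining time then makes [y^2]
    larger by the factor [sqrt (lam / |mu|)], which contradicts the bound on
    [p]. *)
Require Import Defs.
From Stdlib Require Import Reals Lra Classical.
From Coquelicot Require Import Coquelicot.
Open Scope R_scope.

(** * Monotonicity, exponential growth and sign preservation *)

Lemma le_of_derive_nonneg (f df : R -> R) (s t : R) :
  s <= t ->
  (forall x, s <= x <= t -> is_derive f x (df x)) ->
  (forall x, s <= x <= t -> 0 <= df x) ->
  f s <= f t.
Proof.
  intros Hst Hd Hpos.
  destruct (MVT_gen f s t df) as [x [Hx E]].
  - rewrite Rmin_left, Rmax_right by lra. intros x Hx. apply Hd; lra.
  - rewrite Rmin_left, Rmax_right by lra. intros x Hx.
    apply continuity_pt_filterlim, (ex_derive_continuous f).
    exists (df x). now apply Hd.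
  - rewrite Rmin_left, Rmax_right in Hx by lra.
    pose proof (Rmult_le_pos _ (t - s) (Hpos x Hx)). lra.
Qed.

Lemma eq_of_derive_0 (f : R -> R) :
  (forall x, is_derive f x 0) -> forall s t, f s = f t.
Proof.
  intros Hd.
  assert (H : forall s t, s <= t -> f s = f t).
  { intros s t Hst. apply Rle_antisym.
    - apply (le_of_derive_nonneg f (fun _ => 0)); auto with real.
    - apply Ropp_le_cancel.
      apply (le_of_derive_nonneg (fun x => - f x) (fun _ => - 0)).
      + exact Hst.
      + intros x _. apply (is_derive_opp f x 0), Hd.
      + intros; lra. }
  intros s t. destruct (Rle_dec s t); [|symmetry]; apply H; lra.
Qed.

Lemma exp_le (x y : R) : x <= y -> exp x <= exp y.
Proof.
  intros [H| ->]; [apply Rlt_le, exp_increasing, H | apply Rle_refl].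
Qed.

(** A Gronwall bound from below: [z x * exp (k * (t - x))] has derivative [g x - k] times itself,
    hence is nondecreasing in [x]. *)
Lemma exp_growth (z g : R -> R) (k s t : R) :
  s <= t ->
  (forall x, s <= x <= t -> is_derive z x (g x * z x)) ->
  (forall x, s <= x <= t -> 0 <= z x) ->
  (forall x, s <= x <= t -> k <= g x) ->
  z s * exp (k * (t - s)) <= z t.
Proof.
  intros Hst Hd Hz Hg.
  assert (H : z s * exp (k * (t - s)) <= z t * exp (k * (t - t))).
  { apply (le_of_derive_nonneg (fun x => z x * exp (k * (t - x)))
      (fun x => (g x - k) * (z x * exp (k * (t - x))))).
    - exact Hst.
    - intros x Hx. pose proof (Hd x Hx) as D.
      auto_derive; [now exists (g x * z x)|].
      rewrite (is_derive_unique (fun x : R => z x) x _ D).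
      unfold Rminus. ring.
    - intros x Hx. specialize (Hz x Hx). specialize (Hg x Hx).
      pose proof (exp_pos (k * (t - x))).
      apply Rmult_le_pos; [lra|]. apply Rmult_le_pos; lra. }
  replace (k * (t - t)) with 0 in H by ring.
  rewrite exp_0 in H. lra.
Qed.

Lemma pos_of_no_root (f : R -> R) (s t : R) :
  s <= t -> (forall x, continuity_pt f x) -> 0 < f s ->
  (forall x, s <= x <= t -> f x <> 0) -> 0 < f t.
Proof.
  intros Hst Hc Hs Hn.
  destruct (Rlt_dec 0 (f t)) as [|Ht]; [assumption|exfalso].
  destruct (IVT_gen f s t 0 Hc) as [x [Hx E]].
  - rewrite Rmin_right, Rmax_left by lra. lra.
  - rewrite Rmin_left, Rmax_right in Hx by lra. now apply (Hn x).
Qed.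

(** * Escape from the unstable axis *)

(** [L] stands for [ln (lam / |mu|)]. In the application [q 0 ^ 2 / p 0 ^ 2] is close to
    [exp L ^ 6]; the seventh power leaves a spare factor [exp L] for the errors. The constant 4.2 is
    just below 6 / sqrt 2, the value given by the claimed time, and 0.26 is just above the 1/4 that
    the claimed bound on [W] needs. *)
Lemma two_phase_escape (a b c L T : R) (p q r : R -> R) :
  0 < a -> 0 < b -> 0 < c -> b <= 201 / 100 * a -> 0 < T ->
  (forall t, is_derive p t (- a * q t * r t)) ->
  (forall t, is_derive q t (b * r t * p t)) ->
  (forall t, is_derive r t (- c * p t * q t)) ->
  r 0 = 0 -> 0 < q 0 ->
  p 0 ^ 2 <= q 0 ^ 2 / 1000 ->
  q 0 ^ 2 <= p 0 ^ 2 * exp L ^ 7 ->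
  100 <= exp L ->
  42 / 10 * L <= sqrt (a * c) * q 0 * T ->
  exists t, 0 < t <= T /\ 26 / 100 * q 0 ^ 2 <= p t ^ 2.
Proof.
  intros Ha Hb Hc Hba HT Dp Dq Dr r0 q0 Hpq HX7 HX HL.
  destruct (classic (exists t, 0 < t <= T /\ 26 / 100 * q 0 ^ 2 <= p t ^ 2))
    as [|Hno]; [assumption|exfalso].
  assert (HL0 : 0 < L).
  { apply exp_lt_inv. rewrite exp_0. lra. }
  assert (Hq2 : 0 < q 0 ^ 2) by now apply pow_lt.
  assert (Hp0 : 0 < p 0 ^ 2).
  { pose proof (pow2_ge_0 (p 0)).
    destruct (Req_dec (p 0 ^ 2) 0) as [E|]; [rewrite E in HX7; lra | lra]. }
  assert (Hp : forall t, 0 <= t <= T -> p t ^ 2 <= 26 / 100 * q 0 ^ 2).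
  { intros t Ht. destruct (Req_dec t 0) as [->|]; [lra|].
    apply Rnot_lt_le; intro; apply Hno; exists t; lra. }
  assert (I1 : forall t, c * p t ^ 2 - a * r t ^ 2 = c * p 0 ^ 2).
  { intros t. transitivity (c * p 0 ^ 2 - a * r 0 ^ 2); [|rewrite r0; ring].
    apply (eq_of_derive_0 (fun t => c * p t ^ 2 - a * r t ^ 2)). intros x.
    pose proof (Dp x) as D1. pose proof (Dr x) as D3.
    auto_derive; [split; [eexists; apply D1|split; [eexists; apply D3|exact I]]|].
    rewrite (is_derive_unique (fun x : R => p x) x _ D1).
    rewrite (is_derive_unique (fun x : R => r x) x _ D3). ring. }
  assert (I2 : forall t, b * p t ^ 2 + a * q t ^ 2 = b * p 0 ^ 2 + a * q 0 ^ 2).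
  { intros t.
    apply (eq_of_derive_0 (fun t => b * p t ^ 2 + a * q t ^ 2)). intros x.
    pose proof (Dp x) as D1. pose proof (Dq x) as D2.
    auto_derive; [split; [eexists; apply D1|split; [eexists; apply D2|exact I]]|].
    rewrite (is_derive_unique (fun x : R => p x) x _ D1).
    rewrite (is_derive_unique (fun x : R => q x) x _ D2). ring. }
  (* By [I2], growth of [p ^ 2] is paid for by [q ^ 2] at the rate [b / a], which is at most
     2.01. *)
  assert (Hqlow : forall t m, p t ^ 2 <= m * q 0 ^ 2 ->
            (1 - 201 / 100 * m) * q 0 ^ 2 <= q t ^ 2).
  { intros t m Hm. apply Rmult_le_reg_l with a; [exact Ha|].
    specialize (I2 t). pose proof (pow2_ge_0 (p t)) as Hpt.
    pose proof (Rmult_le_compat_r _ _ _ Hpt Hba).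
    pose proof (Rmult_le_compat_l _ _ _ (Rlt_le _ _ Ha) Hm).
    pose proof (Rmult_lt_0_compat _ _ Hb Hp0). nra. }
  assert (Hcq : forall x, continuity_pt q x).
  { intros x. apply continuity_pt_filterlim, (ex_derive_continuous q).
    eexists; apply Dq. }
  assert (Hqpos : forall t, 0 <= t <= T -> 0 < q t).
  { intros t Ht. apply (pos_of_no_root q 0 t); try tauto.
    intros x Hx E. pose proof (Hqlow x (26/100) (Hp x ltac:(lra))) as H.
    rewrite E in H. lra. }
  assert (Hqroot : forall t m k, 0 <= t <= T -> p t ^ 2 <= m * q 0 ^ 2 ->
            0 <= k -> k ^ 2 <= 1 - 201 / 100 * m -> k * q 0 <= q t).
  { intros t m k Ht Hm Hk Hkm.
    pose proof (Hqpos t Ht). pose proof (Hqlow t m Hm).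
    pose proof (Rmult_le_compat_r _ _ _ (Rlt_le _ _ Hq2) Hkm).
    apply Rnot_lt_le; intro. nra. }
  set (K := sqrt (a * c)) in *.
  assert (HK : 0 < K) by (apply sqrt_lt_R0; nra).
  assert (Esa := sqrt_sqrt a (Rlt_le _ _ Ha)).
  assert (Esc := sqrt_sqrt c (Rlt_le _ _ Hc)).
  assert (EK : K = sqrt a * sqrt c) by (apply sqrt_mult; lra).
  set (sa := sqrt a) in *. set (sc := sqrt c) in *. clearbody sa sc K.
  (* Squaring [y] treats both signs of [p 0] at once and supplies the nonnegativity that
     [exp_growth] asks for. *)
  set (z := fun t => (sc * p t - sa * r t) ^ 2).
  assert (z0 : z 0 = c * p 0 ^ 2).
  { unfold z. rewrite r0. rewrite <- Esc. ring. }
  assert (Hz : forall t, 0 <= z t) by (intros t; apply pow2_ge_0).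
  assert (Dz : forall t, is_derive z t (2 * K * q t * z t)).
  { intros t. pose proof (Dp t) as D1. pose proof (Dr t) as D3. unfold z.
    auto_derive; [split; [eexists; apply D1|split; [eexists; apply D3|exact I]]|].
    rewrite (is_derive_unique (fun x : R => p x) t _ D1).
    rewrite (is_derive_unique (fun x : R => r x) t _ D3).
    rewrite EK, <- Esa, <- Esc. ring. }
  (* [sc * p + sa * r] has product [c p(0)^2] with [sc * p - sa * r]. *)
  assert (Ez : forall t, 4 * (c * p t ^ 2) * z t = (z t + c * p 0 ^ 2) ^ 2).
  { intros t. rewrite <- (I1 t). unfold z. rewrite <- Esa, <- Esc. ring. }
  assert (Hgrow : forall s t k, 0 <= s -> s <= t -> t <= T ->
            (forall x, s <= x <= t -> k * q 0 <= q x) ->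
            z s * exp (2 * K * (k * q 0) * (t - s)) <= z t).
  { intros s t k Hs Hst HtT Hk.
    apply (exp_growth z (fun x => 2 * K * q x)); auto.
    intros x Hx. apply Rmult_le_compat_l; [lra|auto]. }
  assert (Hmono : forall s t, 0 <= s -> s <= t -> t <= T -> z s <= z t).
  { intros s t Hs Hst HtT.
    assert (G := Hgrow s t 0 Hs Hst HtT).
    replace (2 * K * (0 * q 0) * (t - s)) with 0 in G by ring.
    rewrite exp_0 in G.
    assert (forall x, s <= x <= t -> 0 * q 0 <= q x) as Q.
    { intros x Hx. pose proof (Hqpos x ltac:(lra)). lra. }
    specialize (G Q). lra. }
  pose proof (Rmult_lt_0_compat _ _ Hc Hp0) as Hcp.
  pose proof (Rmult_lt_0_compat _ _ Hc Hq2) as Hcq2.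
  assert (Hz1 : 2 / 10 * (c * q 0 ^ 2) <= z (9 / 10 * T)).
  { apply Rnot_lt_le; intro Hlt.
    assert (Hq : forall x, 0 <= x <= 9 / 10 * T -> 94 / 100 * q 0 <= q x).
    { intros x Hx. apply Hqroot with (m := 51 / 1000); try lra.
      assert (A1 := Hmono 0 x ltac:(lra) ltac:(lra) ltac:(lra)).
      assert (A2 := Hmono x (9 / 10 * T) ltac:(lra) ltac:(lra) ltac:(lra)).
      rewrite z0 in A1. specialize (Ez x).
      apply Rmult_le_reg_l with (4 * c); [lra|].
      (* Since [c * p 0 ^ 2 = z 0 <= z x], the square in [Ez] is at most
         [z x * (z x + 3 * (c * p 0 ^ 2))]. *)
      assert (4 * (c * p x ^ 2) <= z x + 3 * (c * p 0 ^ 2)).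
      { apply Rmult_le_reg_r with (z x); [lra|]. rewrite Ez. nra. }
      pose proof (Rmult_le_compat_l _ _ _ (Rlt_le _ _ Hc) Hpq). lra. }
    assert (G := Hgrow 0 (9 / 10 * T) (94 / 100) ltac:(lra) ltac:(lra) ltac:(lra) Hq).
    (* The exponent is at least 2 * 0.94 * 0.9 * 4.2 * [L], about 7.1 [L]. So [z] would reach
       [c * q 0 ^ 2], contradicting [Hlt]. *)
    assert (E : exp L ^ 7 <= exp (2 * K * (94 / 100 * q 0) * (9 / 10 * T - 0))).
    { rewrite <- Rpower_pow by apply exp_pos. unfold Rpower.
      rewrite ln_exp. apply exp_le. simpl INR. lra. }
    rewrite z0 in G.
    pose proof (Rmult_le_compat_l _ _ _ (Rlt_le _ _ Hcp) E).
    pose proof (Rmult_le_compat_l _ _ _ (Rlt_le _ _ Hc) HX7). lra. }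
  assert (G := Hgrow (9 / 10 * T) T (69 / 100) ltac:(lra) ltac:(lra) ltac:(lra)).
  assert (Hq : forall x, 9 / 10 * T <= x <= T -> 69 / 100 * q 0 <= q x).
  { intros x Hx. apply Hqroot with (m := 26 / 100); try lra. apply Hp; lra. }
  specialize (G Hq).
  (* Here the exponent is at least 2 * 0.69 * 0.1 * 4.2 * [L], which exceeds [L / 2]. *)
  assert (E : 10 <= exp (2 * K * (69 / 100 * q 0) * (T - 9 / 10 * T))).
  { apply Rle_trans with (exp (L / 2)); [|apply exp_le; lra].
    assert (S : exp (L / 2) * exp (L / 2) = exp L)
      by (rewrite <- exp_plus; f_equal; lra).
    pose proof (exp_pos (L / 2)). nra. }
  assert (Hz2 : 2 * (c * q 0 ^ 2) <= z T).
  { apply Rle_trans with (2 := G).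
    replace (2 * (c * q 0 ^ 2)) with (2 / 10 * (c * q 0 ^ 2) * 10) by field.
    apply Rmult_le_compat; lra. }
  (* [Ez] gives [4 * (c * p T ^ 2) >= z T], so [Hz2] forces [p T ^ 2 >= q 0 ^ 2 / 2], beyond the
     bound 0.26 in [Hp]. *)
  pose proof (Rmult_le_compat_l _ _ _ (Rlt_le _ _ Hc) (Hp T ltac:(lra))).
  specialize (Ez T).
  nra.
Qed.

(** * Application to orbits and to the norm *)

Lemma orbit_is_derive (lam mu nu : R) (p q r : R -> R) :
  is_orbit lam mu nu p q r ->
  forall t, is_derive p t (- (mu - nu) * q t * r t) /\
            is_derive q t ((lam - nu) * r t * p t) /\
            is_derive r t (- (lam - mu) * p t * q t).
Proof.
  intros H t. destruct (H t) as (E1 & E2 & E3 & F1 & F2 & F3).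
  apply Derive_correct in E1. apply Derive_correct in E2. apply Derive_correct in E3.
  split; [|split].
  - replace (- (mu - nu) * q t * r t) with (Derive p t) by lra. exact E1.
  - replace ((lam - nu) * r t * p t) with (Derive q t) by lra. exact E2.
  - replace (- (lam - mu) * p t * q t) with (Derive r t) by lra. exact E3.
Qed.

(** This symmetry also preserves [W], and so reduces negative [q 0] to positive [q 0]. *)
Lemma is_orbit_opp_qr (lam mu nu : R) (p q r : R -> R) :
  is_orbit lam mu nu p q r ->
  is_orbit lam mu nu p (fun t => - q t) (fun t => - r t).
Proof.
  intros H t. destruct (H t) as (E1 & E2 & E3 & F1 & F2 & F3).
  split; [exact E1|split; [now apply (ex_derive_opp q)|
    split; [now apply (ex_derive_opp r)|]]].
  rewrite !Derive_opp. repeat split; lra.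
Qed.

(** Turns the growth of [p] into growth of [r]: at the escape time both contribute about equally to
    the lower bound for [W]. *)
Lemma orbit_p_r_conserved (lam mu nu : R) (p q r : R -> R) :
  is_orbit lam mu nu p q r ->
  forall t, (lam - mu) * p t ^ 2 - (mu - nu) * r t ^ 2 =
            (lam - mu) * p 0 ^ 2 - (mu - nu) * r 0 ^ 2.
Proof.
  intros H t.
  apply (eq_of_derive_0 (fun t => (lam - mu) * p t ^ 2 - (mu - nu) * r t ^ 2)).
  intros x. destruct (orbit_is_derive _ _ _ _ _ _ H x) as (D1 & _ & D3).
  auto_derive; [split; [eexists; apply D1|split; [eexists; apply D3|exact I]]|].
  rewrite (is_derive_unique (fun x : R => p x) x _ D1).
  rewrite (is_derive_unique (fun x : R => r x) x _ D3). ring.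
Qed.

Lemma Rabs_lt_bounds (x e : R) : Rabs (x - 1) < e -> 1 - e < x < 1 + e.
Proof. intros H. apply Rabs_def2 in H. lra. Qed.

Lemma growth_of_pos_q (lam mu nu : R) (p q r : R -> R) :
  let W := H3_norm_sq lam mu nu p q r in
  is_orbit lam mu nu p q r ->
  lam > mu -> mu > nu -> lam * nu < 0 -> mu <> 0 ->
  Rabs mu / lam < 1 / 1000 ->
  Rabs (lam / Rabs nu - 1) < 1 / 1000 ->
  0 < W 0 ->
  W 0 = lam ^ 6 * p 0 ^ 2 + mu ^ 6 * q 0 ^ 2 ->
  Rabs (2 * lam ^ 6 * p 0 ^ 2 / W 0 - 1) < 1 / 1000 ->
  Rabs (2 * mu ^ 6 * q 0 ^ 2 / W 0 - 1) < 1 / 1000 ->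
  0 < q 0 ->
  exists tstar : R,
    0 < tstar /\
    W tstar >= 1 / 4 * (lam / mu) ^ 6 * W 0 /\
    tstar <= 6 / sqrt (W 0) * mu ^ 2 * ln (lam / Rabs mu) * / (lam / Rabs mu).
Proof.
  intros W Horb Hlm Hmn Hln Hmu Hx Hn HW0 EW0 HP HQ Hq0.
  assert (Hlam : 0 < lam) by nra.
  assert (Hnu : nu < 0) by nra.
  rewrite (Rabs_left nu Hnu) in Hn. apply Rabs_lt_bounds in Hn.
  apply Rabs_lt_bounds in HP. apply Rabs_lt_bounds in HQ.
  assert (Hm : 0 < Rabs mu) by now apply Rabs_pos_lt.
  assert (Hmb : - Rabs mu <= mu <= Rabs mu)
    by (split; [pose proof (Rle_abs (- mu)) as A; rewrite Rabs_Ropp in A; lra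
               |apply Rle_abs]).
  assert (Em2 : mu ^ 2 = Rabs mu ^ 2) by (symmetry; apply pow2_abs).
  assert (Em6 : mu ^ 6 = Rabs mu ^ 6)
    by (replace (mu ^ 6) with ((mu ^ 2) ^ 3) by ring; rewrite Em2; ring).
  set (m := Rabs mu) in *.
  set (X := lam / m).
  assert (EX : lam = X * m) by (unfold X; field; lra).
  assert (Hml : 1000 * m < lam).
  { apply Rmult_lt_reg_r with (/ lam); [now apply Rinv_0_lt_compat|].
    rewrite Rinv_r by lra. unfold Rdiv in Hx. lra. }
  assert (HX : 1000 < X) by (apply Rmult_lt_reg_r with m; [|rewrite <- EX]; lra).
  assert (Hnl : 999 / 1000 * - nu < lam < 1001 / 1000 * - nu).
  { split.
    - apply Rmult_lt_reg_r with (/ - nu); [apply Rinv_0_lt_compat; lra|].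
      rewrite Rmult_assoc, Rinv_r by lra. unfold Rdiv in Hn. lra.
    - apply Rmult_lt_reg_r with (/ - nu); [apply Rinv_0_lt_compat; lra|].
      rewrite Rmult_assoc, Rinv_r by lra. unfold Rdiv in Hn. lra. }
  assert (HP' : 999 / 2000 * W 0 < lam ^ 6 * p 0 ^ 2 < 1001 / 2000 * W 0).
  { assert (E : 2 * lam ^ 6 * p 0 ^ 2 = 2 * lam ^ 6 * p 0 ^ 2 / W 0 * W 0)
      by (field; lra).
    set (u := 2 * lam ^ 6 * p 0 ^ 2 / W 0) in *. nra. }
  assert (HQ' : 999 / 2000 * W 0 < m ^ 6 * q 0 ^ 2 < 1001 / 2000 * W 0).
  { rewrite <- Em6.
    assert (E : 2 * mu ^ 6 * q 0 ^ 2 = 2 * mu ^ 6 * q 0 ^ 2 / W 0 * W 0)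
      by (field; lra).
    set (u := 2 * mu ^ 6 * q 0 ^ 2 / W 0) in *. nra. }
  clear HP HQ Hn Hx.
  assert (r0 : r 0 = 0).
  { unfold W, H3_norm_sq in EW0.
    assert (nu ^ 6 * r 0 ^ 2 = 0) as [E|E]%Rmult_integral by lra.
    - exfalso. now apply (pow_nonzero nu 6); [lra|].
    - destruct (Req_dec (r 0) 0) as [|N]; [assumption|].
      exfalso. now apply (pow_nonzero (r 0) 2). }
  assert (Hm6 : 0 < m ^ 6) by now apply pow_lt.
  assert (HX6 : 2000 <= X ^ 6).
  { apply Rle_trans with (1000 ^ 6); [lra|]. apply pow_incr. lra. }
  assert (El6 : lam ^ 6 = X ^ 6 * m ^ 6) by (rewrite EX; ring).
  assert (HL : 0 < ln X) by (rewrite <- ln_1; apply ln_increasing; lra).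
  assert (EL : exp (ln X) = X) by (apply exp_ln; lra).
  set (L := ln X) in *.
  set (S := sqrt (W 0)).
  assert (HS : 0 < S) by now apply sqrt_lt_R0.
  assert (ES : S * S = W 0) by (apply sqrt_sqrt; lra).
  set (T := 6 / S * mu ^ 2 * L * / X).
  assert (HiX : 0 < / X) by (apply Rinv_0_lt_compat; lra).
  assert (HT : 0 < T).
  { unfold T. rewrite Em2. repeat apply Rmult_lt_0_compat; try lra.
    now apply Rinv_0_lt_compat. }
  assert (ET : T * (S * lam) = 6 * m ^ 3 * L).
  { unfold T. rewrite Em2, EX. field. lra. }
  assert (Hp0 : p 0 ^ 2 <= q 0 ^ 2 / 1000).
  { apply Rmult_le_reg_l with (m ^ 6); [exact Hm6|].
    assert (A : 2000 * (m ^ 6 * p 0 ^ 2) <= X ^ 6 * (m ^ 6 * p 0 ^ 2)).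
    { apply Rmult_le_compat_r; [|exact HX6].
      apply Rmult_le_pos; [lra|apply pow2_ge_0]. }
    rewrite <- (Rmult_assoc (X ^ 6)), <- El6 in A. lra. }
  assert (D := orbit_is_derive _ _ _ _ _ _ Horb).
  destruct (two_phase_escape (mu - nu) (lam - nu) (lam - mu) L T p q r)
    as [t [Ht Hpt]]; try lra; try (intros; apply D).
  - rewrite EL. apply Rmult_le_reg_l with (m ^ 6); [exact Hm6|].
    replace (m ^ 6 * (p 0 ^ 2 * X ^ 7)) with (X * (lam ^ 6 * p 0 ^ 2))
      by (rewrite El6; ring).
    nra.
  (* After squaring, [ET] and the size of [m ^ 6 * q 0 ^ 2] reduce the claim to 4.2^2 = 17.64 being
     below 36 * 0.99 * 0.4995, about 17.8. *)
  - apply Rsqr_incr_0_var.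
    2: { apply Rmult_le_pos; [apply Rmult_le_pos; [apply sqrt_pos|]|]; lra. }
    unfold Rsqr.
    replace (sqrt ((mu - nu) * (lam - mu)) * q 0 * T *
             (sqrt ((mu - nu) * (lam - mu)) * q 0 * T))
      with ((mu - nu) * (lam - mu) * (q 0 * T) ^ 2).
    2: { rewrite <- (sqrt_sqrt ((mu - nu) * (lam - mu))) at 1; [ring|].
         apply Rmult_le_pos; lra. }
    assert (A : 99 / 100 * lam ^ 2 <= (mu - nu) * (lam - mu)).
    { apply Rle_trans with ((995 / 1000 * lam) * (995 / 1000 * lam)); [nra|].
      apply Rmult_le_compat; lra. }
    apply Rmult_le_reg_r with (W 0); [exact HW0|].
    assert (B : lam ^ 2 * (q 0 * T) ^ 2 * W 0 = 36 * L ^ 2 * (m ^ 6 * q 0 ^ 2)).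
    { rewrite <- ES.
      replace (lam ^ 2 * (q 0 * T) ^ 2 * (S * S))
        with ((T * (S * lam)) ^ 2 * q 0 ^ 2) by ring.
      rewrite ET. ring. }
    assert (C : 0 <= (q 0 * T) ^ 2 * W 0)
      by (apply Rmult_le_pos; [apply pow2_ge_0|lra]).
    pose proof (Rmult_le_compat_r _ _ _ C A).
    pose proof (pow_lt L 2 HL). nra.
  - exists t. split; [lra|split; [|fold T; lra]].
    assert (I := orbit_p_r_conserved _ _ _ _ _ _ Horb t).
    rewrite r0 in I.
    assert (Hr : 99 / 100 * (p t ^ 2 - p 0 ^ 2) <= r t ^ 2).
    { apply Rmult_le_reg_l with (mu - nu); [lra|].
      assert (A : (mu - nu) * (99 / 100) <= lam - mu) by lra.
      assert (B : 0 <= p t ^ 2 - p 0 ^ 2) by (pose proof (pow2_ge_0 (q 0)); lra).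
      pose proof (Rmult_le_compat_r _ _ _ B A). lra. }
    assert (Hn6 : 99 / 100 * lam ^ 6 <= nu ^ 6).
    { replace (nu ^ 6) with ((- nu) ^ 6) by ring.
      apply Rle_trans with ((999 / 1000 * lam) ^ 6).
      - rewrite Rpow_mult_distr. apply Rmult_le_compat_r; [|lra].
        apply Rlt_le, pow_lt, Hlam.
      - apply pow_incr. lra. }
    assert (Hl6 : 0 < lam ^ 6) by now apply pow_lt.
    assert (Ht6 : (lam / mu) ^ 6 = X ^ 6).
    { unfold X, Rdiv. rewrite !Rpow_mult_distr, !pow_inv, Em6. reflexivity. }
    rewrite Ht6. unfold W at 1, H3_norm_sq. apply Rle_ge.
    assert (A : 99 / 100 * lam ^ 6 * r t ^ 2 <= nu ^ 6 * r t ^ 2)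
      by (apply Rmult_le_compat_r; [apply pow2_ge_0|exact Hn6]).
    (* Numerically 0.26 + 0.99^2 * (0.26 - 0.001) > 0.51. With [C] below, the bound on [W] follows
       from 0.51 * 0.4995 > 1/4. *)
    assert (B : 51 / 100 * q 0 ^ 2 <= p t ^ 2 + 99 / 100 * r t ^ 2)
      by (pose proof (pow2_ge_0 (q 0)); lra).
    pose proof (Rmult_le_compat_l _ _ _ (Rlt_le _ _ Hl6) B) as B'.
    assert (C : 999 / 2000 * W 0 * X ^ 6 <= lam ^ 6 * q 0 ^ 2).
    { rewrite El6. replace (X ^ 6 * m ^ 6 * q 0 ^ 2) with (m ^ 6 * q 0 ^ 2 * X ^ 6)
        by ring. apply Rmult_le_compat_r; lra. }
    assert (0 <= mu ^ 6 * q t ^ 2)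
      by (rewrite Em6; apply Rmult_le_pos; [lra|apply pow2_ge_0]).
    pose proof (Rmult_lt_0_compat _ _ HW0 (Rlt_le_trans 0 2000 _ ltac:(lra) HX6)).
    lra.
Qed.

(* The asymptotic hypotheses are rendered by one threshold [delta], uniform in
   the parameters and in the orbit. *)
Theorem theorem3p9 :
  exists delta : R, 0 < delta /\
  forall (lam mu nu : R) (p q r : R -> R),
    let W := H3_norm_sq lam mu nu p q r in
    is_orbit lam mu nu p q r ->
    lam > mu -> mu > nu ->
    lam * nu < 0 ->
    mu <> 0 ->
    Rabs mu / lam < delta ->
    Rabs (lam / Rabs nu - 1) < delta ->
    0 < W 0 ->
    W 0 = lam ^ 6 * p 0 ^ 2 + mu ^ 6 * q 0 ^ 2 ->
    Rabs (2 * lam ^ 6 * p 0 ^ 2 / W 0 - 1) < delta ->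
    Rabs (2 * mu ^ 6 * q 0 ^ 2 / W 0 - 1) < delta ->
    exists tstar : R,
      0 < tstar /\
      W tstar >= 1 / 4 * (lam / mu) ^ 6 * W 0 /\
      tstar <= 6 / sqrt (W 0) * mu ^ 2 * ln (lam / Rabs mu) * / (lam / Rabs mu).
Proof.
  exists (1 / 1000). split; [lra|].
  intros lam mu nu p q r W Horb Hlm Hmn Hln Hmu Hx Hn HW0 EW0 HP HQ.
  destruct (Rtotal_order (q 0) 0) as [Hq|[Hq|Hq]].
  - assert (EW : forall t,
      H3_norm_sq lam mu nu p (fun t => - q t) (fun t => - r t) t = W t)
      by (intros t; unfold W, H3_norm_sq; ring).
    assert (Eq : (- q 0) ^ 2 = q 0 ^ 2) by ring.
    destruct (growth_of_pos_q lam mu nu p (fun t => - q t) (fun t => - r t))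
      as [t Ht]; rewrite ?EW, ?Eq; auto; [now apply is_orbit_opp_qr|lra|].
    exists t. now rewrite !EW in Ht.
  - exfalso. apply Rabs_lt_bounds in HQ. rewrite Hq in HQ.
    unfold Rdiv in HQ. simpl in HQ. lra.
  - now apply growth_of_pos_q.
Qed.
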